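(* Let $(A_i)_{i\in I}$ be a non-empty family of residuated lattices in each of which $\odot =\wedge$, and let $A=\prod _{i\in I}A_i$ with componentwise operations. Then the following are equivalent: (1) $A$ has the Boolean Lifting Property (BLP); (2) for every $i\in I$, $A_i$ has BLP.
   Context: A residuated lattice is a commutative integral bounded one: a structure $(A,\vee ,\wedge ,\odot ,\rightarrow ,0,1)$ such that $(A,\vee ,\wedge ,0,1)$ is a bounded lattice, $(A,\odot ,1)$ is a commutative monoid, and $a\leq b\rightarrow c$ iff $a\odot b\leq c$ for all $a,b,c$. Write $a\leftrightarrow b=(a\rightarrow b)\wedge (b\rightarrow a)$. $\mathcal{B}(A)$ is the set of complemented elements of the bounded lattice reduct of $A$. A filter of $A$ is a nonempty subset closed under $\odot$ and upward closed. For a filter $F$, $A/F$ is the quotient residuated lattice by the congruence $a\equiv b$ iff $a\leftrightarrow b\in F$, with classes $a/F$. $F$ has BLP iff for every $f\in \mathcal{B}(A/F)$ there is $e\in \mathcal{B}(A)$ with $e/F=f$. $A$ has BLP iff all its filters have BLP. *)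

(* Defs.v *)
From HB Require Import structures.
From mathcomp Require Import all_boot all_order.
From mathcomp Require Import boolp classical_sets.

Set Implicit Arguments.
Unset Strict Implicit.
Unset Printing Implicit Defensive.
Local Set Warnings "-redundant-canonical-projection".

Import Order.TTheory.
Local Open Scope classical_set_scope.
Local Open Scope quotient_scope.
Local Open Scope order_scope.

Reserved Notation "x ⊙ y" (at level 40, left associativity).
Reserved Notation "x ⇒ y" (at level 55, right associativity).
Reserved Notation "x ⇔ y" (at level 55, no associativity).

(* Commutative, integral (the unit of the monoid is \top), bounded. *)
HB.mixin Record TBLattice_isResiduated d T of Order.TBLattice d T := {
  rmul : T -> T -> T;
  rimp : T -> T -> T;
  rmulA : associative rmul;
  rmulC : commutative rmul;
  rmul1x : left_id \top rmul;
  residuation : forall a b c : T, (a <= rimp b c) = (rmul a b <= c)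
}.

#[short(type="residuatedLatticeType")]
HB.structure Definition ResiduatedLattice d :=
  { T of Order.TBLattice d T & TBLattice_isResiduated d T }.

Notation "x ⊙ y" := (rmul x y) : order_scope.
Notation "x ⇒ y" := (rimp x y) : order_scope.

Definition rbiimp d (A : residuatedLatticeType d) (a b : A) : A :=
  (a ⇒ b) `&` (b ⇒ a).

Notation "x ⇔ y" := (rbiimp x y) : order_scope.

Definition complemented d (L : tbLatticeType d) : set L :=
  [set e | exists e' : L, e `&` e' = \bot /\ e `|` e' = \top].

(* A filter need not be proper. *)
Record rfilter d (A : residuatedLatticeType d) := RFilter {
  rfilter_set :> A -> Prop;
  rfilter_neq0 : exists a, rfilter_set a;
  rfilterM : forall a b, rfilter_set a -> rfilter_set b -> rfilter_set (a ⊙ b);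
  rfilter_up : forall a b, a <= b -> rfilter_set a -> rfilter_set b
}.

Section ResiduatedLatticeTheory.
Context {d} {A : residuatedLatticeType d}.
Implicit Types a b c x y z : A.

Lemma rmulx1 a : a ⊙ \top = a.
Proof. by rewrite rmulC rmul1x. Qed.

Lemma rmulACA a b c x : (a ⊙ b) ⊙ (c ⊙ x) = (a ⊙ c) ⊙ (b ⊙ x).
Proof. by rewrite -!rmulA (rmulA b) (rmulC b c) !rmulA. Qed.

Lemma rmul_impl a b : (a ⇒ b) ⊙ a <= b.
Proof. by rewrite -residuation. Qed.

Lemma rmul_le2r a b c : a <= b -> a ⊙ c <= b ⊙ c.
Proof. by move=> ab; rewrite -residuation (le_trans ab) // residuation. Qed.

Lemma rmul_le2 a b c x : a <= b -> c <= x -> a ⊙ c <= b ⊙ x.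
Proof.
move=> ab cx; apply: le_trans (rmul_le2r c ab) _.
by rewrite !(rmulC b); exact: rmul_le2r.
Qed.

Lemma rmul_lel a b : a ⊙ b <= a.
Proof. by rewrite -[leRHS]rmulx1; apply: rmul_le2 => //; exact: lex1. Qed.

Lemma rmul_ler a b : a ⊙ b <= b.
Proof. by rewrite rmulC rmul_lel. Qed.

Variable F : rfilter A.

Lemma rfilter1 : F \top.
Proof. by have [a Fa] := rfilter_neq0 F; apply: rfilter_up Fa; exact: lex1. Qed.

Lemma rfilterI a b : F (a `&` b) <-> F a /\ F b.
Proof.
split=> [Fab|[Fa Fb]].
  by split; apply: rfilter_up Fab; rewrite ?leIl ?leIr.
by apply: rfilter_up (rfilterM Fa Fb); rewrite lexI rmul_lel rmul_ler.
Qed.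

Lemma rfilter_impP a b : F (a ⇒ b) <-> exists2 f, F f & f ⊙ a <= b.
Proof.
split=> [Fab|[f Ff fab]]; first by exists (a ⇒ b) => //; exact: rmul_impl.
by apply: rfilter_up Ff; rewrite residuation.
Qed.

Lemma rfilter_imp_le a b : a <= b -> F (a ⇒ b).
Proof.
by move=> ab; apply/rfilter_impP; exists \top; [exact: rfilter1|rewrite rmul1x].
Qed.

Lemma rfilter_imp_trans a b c : F (a ⇒ b) -> F (b ⇒ c) -> F (a ⇒ c).
Proof.
move=> /rfilter_impP[f Ff fab] /rfilter_impP[g Fg gbc]; apply/rfilter_impP.
exists (g ⊙ f); first exact: rfilterM.
by rewrite -rmulA (le_trans _ gbc) // rmul_le2.
Qed.

Lemma rfilter_imp_meet a b c : F (a ⇒ b `&` c) <-> F (a ⇒ b) /\ F (a ⇒ c).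
Proof.
split=> [Fabc|[/rfilter_impP[f Ff fab] /rfilter_impP[g Fg gac]]].
  by split; apply: rfilter_imp_trans Fabc (rfilter_imp_le _); rewrite ?leIl ?leIr.
apply/rfilter_impP; exists (f ⊙ g); first exact: rfilterM.
rewrite lexI (le_trans _ fab) ?(le_trans _ gac) //;
  by apply: rmul_le2r; rewrite ?rmul_lel ?rmul_ler.
Qed.

Lemma rfilter_imp_join a b c : F (a `|` b ⇒ c) <-> F (a ⇒ c) /\ F (b ⇒ c).
Proof.
split=> [Fabc|[/rfilter_impP[f Ff fac] /rfilter_impP[g Fg gbc]]].
  by split; apply: rfilter_imp_trans (rfilter_imp_le _) Fabc; rewrite ?leUl ?leUr.
apply/rfilter_impP; exists (f ⊙ g); first exact: rfilterM.
rewrite rmulC -residuation leUx !residuation !(rmulC _ (f ⊙ g)).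
rewrite (le_trans _ fac) ?(le_trans _ gbc) //;
  by apply: rmul_le2r; rewrite ?rmul_lel ?rmul_ler.
Qed.

Lemma rfilter_imp_mul a b x y :
  F (a ⇒ b) -> F (x ⇒ y) -> F (a ⊙ x ⇒ b ⊙ y).
Proof.
move=> /rfilter_impP[f Ff fab] /rfilter_impP[g Fg gxy]; apply/rfilter_impP.
by exists (f ⊙ g); [exact: rfilterM|rewrite rmulACA rmul_le2].
Qed.

Lemma rfilter_imp_residuation a b c : F (a ⇒ (b ⇒ c)) <-> F (a ⊙ b ⇒ c).
Proof.
by split=> /rfilter_impP[f Ff h]; apply/rfilter_impP; exists f => //;
  move: h; rewrite residuation rmulA.
Qed.

Definition rcong : rel A := fun a b => `[< F (a ⇔ b) >].

Lemma rcongP a b : reflect (F (a ⇒ b) /\ F (b ⇒ a)) (rcong a b).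
Proof. by apply: (iffP (asboolP _)) => /rfilterI. Qed.

Lemma rcong_refl : reflexive rcong.
Proof. by move=> a; apply/rcongP; split; exact: rfilter_imp_le. Qed.

Lemma rcong_sym : symmetric rcong.
Proof. by move=> a b; apply/rcongP/rcongP => -[]. Qed.

Lemma rcong_trans : transitive rcong.
Proof.
move=> b a c /rcongP[ab ba] /rcongP[bc cb]; apply/rcongP.
by split; [exact: rfilter_imp_trans ab bc|exact: rfilter_imp_trans cb ba].
Qed.

Canonical rcong_equiv := EquivRel rcong rcong_refl rcong_sym rcong_trans.

Lemma rcong_meet a b x y :
  rcong a b -> rcong x y -> rcong (a `&` x) (b `&` y).
Proof.
move=> /rcongP[ab ba] /rcongP[xy yx].
have le u v (uv : u <= v) := rfilter_imp_le uv.
apply/rcongP; split; apply/rfilter_imp_meet; split.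
- exact: rfilter_imp_trans (le _ _ (leIl _ _)) ab.
- exact: rfilter_imp_trans (le _ _ (leIr _ _)) xy.
- exact: rfilter_imp_trans (le _ _ (leIl _ _)) ba.
- exact: rfilter_imp_trans (le _ _ (leIr _ _)) yx.
Qed.

Lemma rcong_join a b x y :
  rcong a b -> rcong x y -> rcong (a `|` x) (b `|` y).
Proof.
move=> /rcongP[ab ba] /rcongP[xy yx].
have le u v (uv : u <= v) := rfilter_imp_le uv.
apply/rcongP; split; apply/rfilter_imp_join; split.
- exact: rfilter_imp_trans ab (le _ _ (leUl _ _)).
- exact: rfilter_imp_trans xy (le _ _ (leUr _ _)).
- exact: rfilter_imp_trans ba (le _ _ (leUl _ _)).
- exact: rfilter_imp_trans yx (le _ _ (leUr _ _)).
Qed.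

Lemma rcong_mul a b x y :
  rcong a b -> rcong x y -> rcong (a ⊙ x) (b ⊙ y).
Proof.
move=> /rcongP[ab ba] /rcongP[xy yx].
by apply/rcongP; split; exact: rfilter_imp_mul.
Qed.

Lemma rcong_imp a b x y :
  rcong a b -> rcong x y -> rcong (a ⇒ x) (b ⇒ y).
Proof.
suff h u v w z : F (v ⇒ u) -> F (w ⇒ z) -> F ((u ⇒ w) ⇒ (v ⇒ z)).
  by move=> /rcongP[ab ba] /rcongP[xy yx]; apply/rcongP; split; exact: h.
move=> vu wz; apply/rfilter_imp_residuation; apply: rfilter_imp_trans wz.
apply: rfilter_imp_trans (rfilter_imp_le (rmul_impl u w)).
by apply: rfilter_imp_mul vu; exact: rfilter_imp_le.
Qed.

Lemma rcong_meet_imp a b : rcong (a `&` b) a <-> F (a ⇒ b).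
Proof.
split=> [/rcongP[_ /rfilter_imp_meet[]]//|ab]; apply/rcongP; split.
  by apply: rfilter_imp_le; rewrite leIl.
by apply/rfilter_imp_meet; split=> //; exact: rfilter_imp_le.
Qed.

End ResiduatedLatticeTheory.

(* The quotient A/F; the class a/F is \pi_(rquot F) a. *)
Definition rquot d (A : residuatedLatticeType d) (F : rfilter A) : Type :=
  {eq_quot rcong_equiv F}.

Section Quotient.
Context {d} {A : residuatedLatticeType d} (F : rfilter A).
Local Notation Q := (rquot F).

HB.instance Definition _ := Choice.on Q.
HB.instance Definition _ := EqQuotient.on Q.

Lemma rquotP (a b : A) : reflect (\pi_Q a = \pi_Q b) (rcong F a b).
Proof. by apply: (iffP idP) => [?|/eqquotP]; first exact/eqquotP. Qed.

Definition rquot_meet : Q -> Q -> Q := lift_op2 Q (fun a b : A => a `&` b).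
Definition rquot_join : Q -> Q -> Q := lift_op2 Q (fun a b : A => a `|` b).
Definition rquot_mul : Q -> Q -> Q := lift_op2 Q (@rmul d A).
Definition rquot_imp : Q -> Q -> Q := lift_op2 Q (@rimp d A).
Definition rquot_le : rel Q := fun x y => rquot_meet x y == x.

Lemma rcong_repr (a : A) : rcong F (repr (\pi_Q a)) a.
Proof. by apply/rquotP; rewrite reprK. Qed.

Lemma pi_rquot_meet : {morph \pi_Q : a b / a `&` b >-> rquot_meet a b}.
Proof.
move=> a b; unlock rquot_meet; apply/rquotP; rewrite rcong_sym.
by apply: rcong_meet; exact: rcong_repr.
Qed.

Lemma pi_rquot_join : {morph \pi_Q : a b / a `|` b >-> rquot_join a b}.
Proof.
move=> a b; unlock rquot_join; apply/rquotP; rewrite rcong_sym.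
by apply: rcong_join; exact: rcong_repr.
Qed.

Lemma pi_rquot_mul : {morph \pi_Q : a b / a ⊙ b >-> rquot_mul a b}.
Proof.
move=> a b; unlock rquot_mul; apply/rquotP; rewrite rcong_sym.
by apply: rcong_mul; exact: rcong_repr.
Qed.

Lemma pi_rquot_imp : {morph \pi_Q : a b / a ⇒ b >-> rquot_imp a b}.
Proof.
move=> a b; unlock rquot_imp; apply/rquotP; rewrite rcong_sym.
by apply: rcong_imp; exact: rcong_repr.
Qed.

Lemma rquot_leP (a b : A) : reflect (F (a ⇒ b)) (rquot_le (\pi_Q a) (\pi_Q b)).
Proof.
rewrite /rquot_le -pi_rquot_meet.
by apply: (iffP eqP) => [/rquotP/rcong_meet_imp|/rcong_meet_imp/rquotP].
Qed.

Lemma rquot_le_refl : reflexive rquot_le.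
Proof. by elim/quotW=> a; apply/rquot_leP/rfilter_imp_le. Qed.

Lemma rquot_le_anti : antisymmetric rquot_le.
Proof.
elim/quotW=> a; elim/quotW=> b /andP[/rquot_leP ab /rquot_leP ba].
exact/rquotP/rcongP.
Qed.

Lemma rquot_le_trans : transitive rquot_le.
Proof.
elim/quotW=> b; elim/quotW=> a; elim/quotW=> c /rquot_leP ab /rquot_leP bc.
by apply/rquot_leP; exact: rfilter_imp_trans ab bc.
Qed.

HB.instance Definition _ := Order.Le_isPOrder.Build d Q
  rquot_le_refl rquot_le_anti rquot_le_trans.

Lemma rquot_meetP (x y z : Q) : (x <= rquot_meet y z) = (x <= y) && (x <= z).
Proof.
elim/quotW: x => a; elim/quotW: y => b; elim/quotW: z => c.
rewrite -pi_rquot_meet; apply/rquot_leP/andP => [/rfilter_imp_meet[]|[]].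
  by split; apply/rquot_leP.
by move=> /rquot_leP ab /rquot_leP ac; apply/rfilter_imp_meet.
Qed.

Lemma rquot_joinP (x y z : Q) : (rquot_join x y <= z) = (x <= z) && (y <= z).
Proof.
elim/quotW: x => a; elim/quotW: y => b; elim/quotW: z => c.
rewrite -pi_rquot_join; apply/rquot_leP/andP => [/rfilter_imp_join[]|[]].
  by split; apply/rquot_leP.
by move=> /rquot_leP ac /rquot_leP bc; apply/rfilter_imp_join.
Qed.

HB.instance Definition _ := Order.POrder_MeetJoin_isLattice.Build d Q
  rquot_meetP rquot_joinP.

Lemma rquot_le0x (x : Q) : \pi_Q \bot <= x.
Proof.
elim/quotW: x => a; apply/rquot_leP/rfilter_imp_le; exact: le0x.
Qed.

Lemma rquot_lex1 (x : Q) : x <= \pi_Q \top.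
Proof.
elim/quotW: x => a; apply/rquot_leP/rfilter_imp_le; exact: lex1.
Qed.

HB.instance Definition _ := Order.hasBottom.Build d Q rquot_le0x.
HB.instance Definition _ := Order.hasTop.Build d Q rquot_lex1.

Lemma rquot_mulA : associative rquot_mul.
Proof.
elim/quotW=> a; elim/quotW=> b; elim/quotW=> c.
by rewrite -!pi_rquot_mul rmulA.
Qed.

Lemma rquot_mulC : commutative rquot_mul.
Proof.
by elim/quotW=> a; elim/quotW=> b; rewrite -!pi_rquot_mul rmulC.
Qed.

Lemma rquot_mul1x : left_id (\top : Q) rquot_mul.
Proof. by elim/quotW=> a; rewrite -pi_rquot_mul rmul1x. Qed.

Lemma rquot_residuation (x y z : Q) :
  (x <= rquot_imp y z) = (rquot_mul x y <= z).
Proof.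
elim/quotW: x => a; elim/quotW: y => b; elim/quotW: z => c.
rewrite -pi_rquot_mul -pi_rquot_imp.
by apply/rquot_leP/rquot_leP => /rfilter_imp_residuation.
Qed.

HB.instance Definition _ := TBLattice_isResiduated.Build d Q
  rquot_mulA rquot_mulC rquot_mul1x rquot_residuation.

End Quotient.

Definition filter_BLP d (A : residuatedLatticeType d) (F : rfilter A) : Prop :=
  forall f : rquot F, complemented f ->
    exists2 e : A, complemented e & \pi_(rquot F) e = f.

Definition BLP d (A : residuatedLatticeType d) : Prop :=
  forall F : rfilter A, filter_BLP F.

Definition rprod (I : Type) (d : I -> Order.disp_t)
    (A : forall i, residuatedLatticeType (d i)) : Type :=
  forall i, A i.

Fact rprod_display : Order.disp_t. Proof. exact: Order.Disp tt tt. Qed.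

Section Product.
Context {I : Type} {d : I -> Order.disp_t}.
Variable A : forall i, residuatedLatticeType (d i).
Local Notation P := (rprod A).
Implicit Types f g h : P.

HB.instance Definition _ := Choice.copy P (forall i, A i).

Definition rprod_meet f g : P := fun i => f i `&` g i.
Definition rprod_join f g : P := fun i => f i `|` g i.
Definition rprod_mul f g : P := fun i => f i ⊙ g i.
Definition rprod_imp f g : P := fun i => f i ⇒ g i.
Definition rprod_bot : P := fun i => \bot.
Definition rprod_top : P := fun i => \top.
Definition rprod_le : rel P := fun f g => `[< forall i, f i <= g i >].

Lemma rprod_le_refl : reflexive rprod_le.
Proof. by move=> f; apply/asboolP. Qed.

Lemma rprod_le_anti : antisymmetric rprod_le.
Proof.
move=> f g /andP[/asboolP fg /asboolP gf]; apply: functional_extensionality_dep.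
by move=> i; apply/le_anti; rewrite fg gf.
Qed.

Lemma rprod_le_trans : transitive rprod_le.
Proof.
move=> g f h /asboolP fg /asboolP gh; apply/asboolP => i.
exact: le_trans (fg i) (gh i).
Qed.

HB.instance Definition _ := Order.Le_isPOrder.Build rprod_display P
  rprod_le_refl rprod_le_anti rprod_le_trans.

Lemma rprod_leP f g : reflect (forall i, f i <= g i) (f <= g).
Proof. exact: asboolP. Qed.

Lemma rprod_meetP f g h : (f <= rprod_meet g h) = (f <= g) && (f <= h).
Proof.
apply/rprod_leP/andP => [fgh|[/rprod_leP fg /rprod_leP fh] i].
  by split; apply/rprod_leP => i; have := fgh i; rewrite lexI => /andP[].
by rewrite lexI fg fh.
Qed.

Lemma rprod_joinP f g h : (rprod_join f g <= h) = (f <= h) && (g <= h).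
Proof.
apply/rprod_leP/andP => [fgh|[/rprod_leP fh /rprod_leP gh] i].
  by split; apply/rprod_leP => i; have := fgh i; rewrite leUx => /andP[].
by rewrite leUx fh gh.
Qed.

HB.instance Definition _ := Order.POrder_MeetJoin_isLattice.Build
  rprod_display P rprod_meetP rprod_joinP.

Lemma rprod_le0x f : rprod_bot <= f.
Proof. by apply/rprod_leP => i; exact: le0x. Qed.

Lemma rprod_lex1 f : f <= rprod_top.
Proof. by apply/rprod_leP => i; exact: lex1. Qed.

HB.instance Definition _ :=
  Order.hasBottom.Build rprod_display P rprod_le0x.
HB.instance Definition _ :=
  Order.hasTop.Build rprod_display P rprod_lex1.

Lemma rprod_mulA : associative rprod_mul.
Proof.
by move=> f g h; apply: functional_extensionality_dep => i; exact: rmulA.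
Qed.

Lemma rprod_mulC : commutative rprod_mul.
Proof.
by move=> f g; apply: functional_extensionality_dep => i; exact: rmulC.
Qed.

Lemma rprod_mul1x : left_id (\top : P) rprod_mul.
Proof.
by move=> f; apply: functional_extensionality_dep => i; exact: rmul1x.
Qed.

Lemma rprod_residuation f g h : (f <= rprod_imp g h) = (rprod_mul f g <= h).
Proof.
by apply/rprod_leP/rprod_leP => fgh i; have := fgh i; rewrite residuation.
Qed.

HB.instance Definition _ := TBLattice_isResiduated.Build
  rprod_display P
  rprod_mulA rprod_mulC rprod_mul1x rprod_residuation.

End Product.

(* Main.v *)
Require Import Defs.
From mathcomp Require Import all_boot all_order.
From mathcomp Require Import boolp.

Import Order.TTheory.

Local Open Scope quotient_scope.
Local Open Scope order_scope.

(** When [⊙] is the meet, BLP can be tested without mentioning filters: it holds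
    iff any two disjoint elements [a], [b] are separated by a complemented
    element, that is, [a <= e] and [b <= e'] for some complements [e], [e'] of
    each other ([BLP_separated]).  Indeed, if [a] and [b] are disjoint, their
    classes are complementary modulo the principal filter of [a `|` b], and a
    Boolean lifting of the class of [a] separates [a] from [b].  Conversely, if
    [a] and [b] are complementary modulo [F], then meeting them with the element
    [a `&` b ⇒ \bot] of [F] makes them disjoint, and a complemented element
    separating the results is congruent to [a] modulo [F].

    The separation property is then easily compared between a product and its
    factors: separating elements are chosen componentwise, and disjoint elements
    of one factor extend by [\bot] to disjoint elements of the product. *)

(** By definition, [complemented e] says that such an [e'] exists. *)
Definition complements {d} {L : tbLatticeType d} (e e' : L) : Prop :=
  e `&` e' = \bot /\ e `|` e' = \top.

(** Any two disjoint elements lie below complementary elements. *)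
Definition separated {d} (L : tbLatticeType d) : Prop :=
  forall a b : L, a `&` b = \bot ->
  exists e e' : L, [/\ complements e e', a <= e & b <= e'].

Section MeetMultiplication.
Context {d} {A : residuatedLatticeType d}.
Hypothesis mulE : forall a b : A, a ⊙ b = a `&` b.
Implicit Types a b e x : A.

Lemma rmul_ge_closed x a b : x <= a -> x <= b -> x <= a ⊙ b.
Proof. by move=> xa xb; rewrite mulE lexI xa. Qed.

(** The filter of all elements above [x]; it is closed under [⊙] because
    [⊙] is the meet. *)
Definition principal x : rfilter A :=
  @RFilter d A (fun a => x <= a) (ex_intro _ x (lexx x)) (@rmul_ge_closed x)
    (fun a b ab xa => le_trans xa ab).

Lemma BLP_imp_separated : BLP A -> separated A.
Proof.
move=> blp a b ab0.
have [|e [e' [ee0 ee1]] /rquotP/rcongP[/= Fea Fae]] :=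
    blp (principal (a `|` b)) (\pi_(rquot (principal (a `|` b))) a).
  exists (\pi_(rquot (principal (a `|` b))) b); split.
    by rewrite -[LHS]pi_rquot_meet ab0.
  rewrite -[LHS]pi_rquot_join; apply/rquotP/rcongP; split.
    exact/rfilter_imp_le/lex1.
  by rewrite /= residuation rmulx1.
exists e, e'; split => //.
  move: Fae; rewrite leUx residuation mulE => /andP[+ _].
  by rewrite meetxx.
have be0 : b `&` e = \bot.
  move: Fea; rewrite leUx !residuation !mulE => /andP[_ bea].
  by apply/le_anti; rewrite le0x -ab0 lexI bea leIl.
have : e `|` e' <= b ⇒ e'.
  by rewrite leUx !residuation !mulE leIl meetC be0 le0x.
by rewrite ee1 residuation rmul1x.
Qed.

Lemma separated_imp_BLP : separated A -> BLP A.
Proof.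
move=> sep F; elim/quotW=> a [g]; elim/quotW: g => b [].
move=> /(etrans (pi_rquot_meet _ _ _))/rquotP/rcongP[Fab0 _].
move=> /(etrans (pi_rquot_join _ _ _))/rquotP/rcongP[_ FabU].
(* [n] lies in [F] and makes [n `&` a], [n `&` b] disjoint. *)
set n := a `&` b ⇒ \bot in Fab0.
have Fab : F (a `|` b).
  by apply: rfilter_up FabU; rewrite -[leLHS]rmulx1 rmul_impl.
have [|e [e' [[ee0 ee1] ane bne']]] := sep (n `&` a) (n `&` b).
  apply/le_anti; rewrite le0x andbT -meetACA meetxx -mulE.
  exact: rmul_impl.
exists e; first by exists e'.
apply/rquotP/rcongP; split; last first.
  by apply: rfilter_up Fab0; rewrite residuation mulE.
apply: rfilter_up (rfilterM Fab Fab0).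
rewrite -residuation leUx !residuation !mulE -!meetA leIl /=.
have -> : b `&` (n `&` e) = \bot; last exact: le0x.
apply/le_anti; rewrite le0x andbT -ee0 meetA (meetC b) meetC.
by rewrite leI2.
Qed.

Lemma BLP_separated : BLP A <-> separated A.
Proof. by split; [exact: BLP_imp_separated|exact: separated_imp_BLP]. Qed.

End MeetMultiplication.

Section Product.
Context {I : Type} {d : I -> Order.disp_t}.
Context {A : forall i, residuatedLatticeType (d i)}.

Lemma rprod_complements (e e' : rprod A) :
  complements e e' <-> forall i, complements (e i) (e' i).
Proof.
split=> [[e0 e1] i|h].
  by split; [exact: (congr1 (@^~ i) e0)|exact: (congr1 (@^~ i) e1)].
by split; apply: functional_extensionality_dep => i; have [] := h i.
Qed.

(** The extension of an element of one factor by [\bot]. *)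
Lemma rprod_single i (a : A i) :
  exists f : rprod A, f i = a /\ forall j, i <> j -> f j = \bot.
Proof.
exists (fun j => if pselect (i = j) is left ij
  then ecast j (A j) ij a else \bot); split=> [|j ij].
  by case: pselect => // ii; rewrite (Prop_irrelevance ii erefl).
by case: pselect.
Qed.

Lemma rprod_separated : separated (rprod A) <-> forall i, separated (A i).
Proof.
split=> [sep i a b ab0|sep f g fg0].
  have [f [fi fj]] := rprod_single i a; have [g [gi _]] := rprod_single i b.
  have [|e [e' [/rprod_complements ee' /rprod_leP fe /rprod_leP ge']]] := sep f g.
    apply: functional_extensionality_dep => j.
    change (f j `&` g j = \bot).
    have [<-|ij] := pselect (i = j); first by rewrite fi gi.
    by rewrite fj // meet0x.
  by exists (e i), (e' i); split; rewrite -?fi -?gi.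
have sepi i := cid (sep i (f i) (g i) (congr1 (@^~ i) fg0)).
exists (fun i => sval (sepi i)), (fun i => sval (cid (svalP (sepi i)))).
split; [apply/rprod_complements => i|apply/rprod_leP => i|apply/rprod_leP => i];
  by case: (svalP (cid (svalP (sepi i)))).
Qed.

End Product.

Theorem proposition5p5 (I : Type) (d : I -> Order.disp_t)
    (A : forall i : I, residuatedLatticeType (d i)) :
  inhabited I ->
  (forall (i : I) (a b : A i), a ⊙ b = a `&` b) ->
  BLP (rprod A) <-> (forall i : I, BLP (A i)).
Proof.
move=> _ mulE.
have mulPE (f g : rprod A) : f ⊙ g = f `&` g.
  by apply: functional_extensionality_dep => i; exact: mulE.
rewrite (BLP_separated mulPE) rprod_separated.
by split=> h i; apply/(BLP_separated (mulE i)).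
Qed.
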